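(* Let $D$ be an integral domain with quotient field $F$, and let $\mathcal{F}(D)$ be the semiprequantale of all nonzero fractional ideals of $D$. A self-map $*$ of $\mathcal{F}(D)$ is a star operation on $D$ if and only if $*$ is a nucleus on $\mathcal{F}(D)$ such that $D^*=D$. Moreover, the following conditions are equivalent for any self-map $*$ of $\mathcal{F}(D)$ such that $D^*=D$. (1) $*$ is a star operation on $D$. (2) $*$ is a closure operation on the poset $\mathcal{F}(D)$ and $*$-multiplication $(I,J)\mapsto(IJ)^*$ on $\mathcal{F}(D)$ is associative. (3) $*$ is a closure operation on the poset $\mathcal{F}(D)$ and $(I^*J^* )^*=(IJ)^*$ for all $I,J\in\mathcal{F}(D)$. (4) For all $I,J,K\in\mathcal{F}(D)$, one has $IJ\subset K^*$ if and only if $IJ^*\subset K^*$. (5) $*=\star|_{\mathcal{F}(D)}$ for some semistar operation $\star$ on $D$ such that $D^\star=D$.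
   Context: A fractional ideal of $D$ is a $D$-submodule $I$ of $F$ such that $aI\subset D$ for some nonzero $a\in F$. $\mathcal{F}(D)$ is ordered by inclusion with the usual multiplication of $D$-submodules. (A semiprequantale is an ordered magma in which every nonempty subset that is finite or bounded above has a supremum, and left and right multiplications distribute over these suprema.) For a self-map write $x^*=*(x)$. A closure operation on a poset is an expansive ($x\le x^*$), order-preserving, idempotent self-map. A nucleus on an ordered magma is a closure operation $*$ with $x^*y^*\le(xy)^*$ for all $x,y$. A star operation on $D$ is a closure operation $*$ on the poset $\mathcal{F}(D)$ such that $D^*=D$ and $(aI)^*=aI^*$ for all nonzero $a\in F$ and all $I\in\mathcal{F}(D)$. A semistar operation on $D$ is a closure operation $\star$ on the poset $\mathcal{K}(D)$ of all nonzero $D$-submodules of $F$ such that $(aI)^\star=aI^\star$ for all nonzero $a\in F$ and all $I\in\mathcal{K}(D)$. *)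

(* Defs.v *)
From HB Require Import structures.
From mathcomp Require Import all_boot all_order all_algebra.
From mathcomp Require Import all_classical.

Set Implicit Arguments.
Unset Strict Implicit.
Unset Printing Implicit Defensive.

Import Order.TTheory GRing.Theory.
Local Open Scope quotient_scope.
Local Open Scope classical_set_scope.
Local Open Scope ring_scope.

Definition closure_operation d (T : porderType d) (c : T -> T) : Prop :=
  [/\ forall x, (x <= c x)%O,
      {homo c : x y / (x <= y)%O}
    & forall x, c (c x) = c x].

HB.mixin Record Magma_isOrdered d T of Order.POrder d T & Magma T := {
  le_mulg : forall x y x' y' : T,
    (x <= x')%O -> (y <= y')%O -> (x * y <= x' * y')%O%g
}.

#[short(type="orderedMagmaType")]
HB.structure Definition OrderedMagma d :=
  {T of Order.POrder d T & Magma T & Magma_isOrdered d T}.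

Definition nucleus d (M : orderedMagmaType d) (c : M -> M) : Prop :=
  closure_operation c /\ forall x y : M, (c x * c y <= c (x * y))%O%g.

HB.mixin Record OrderedMagma_isSemiprequantale d T of OrderedMagma d T := {
  supremums_neq0 : forall X : set T, X !=set0 ->
    finite_set X \/ has_ubound X -> supremums X !=set0;
  supremums_mull : forall (a : T) (X : set T) (s : T), X !=set0 ->
    finite_set X \/ has_ubound X -> supremums X s ->
    supremums [set (a * x)%g | x in X] (a * s)%g;
  supremums_mulr : forall (a : T) (X : set T) (s : T), X !=set0 ->
    finite_set X \/ has_ubound X -> supremums X s ->
    supremums [set (x * a)%g | x in X] (s * a)%g
}.

#[short(type="semiprequantaleType")]
HB.structure Definition Semiprequantale d :=
  {T of OrderedMagma d T & OrderedMagma_isSemiprequantale d T}.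

Section Submodules.
Variable D : idomainType.
Local Notation F := {fraction D}.
Local Notation "x %:F" := (tofrac x).
Implicit Types (A B : set F) (x y a : F).

Definition is_submod A : Prop :=
  [/\ A 0,
      forall x y, A x -> A y -> A (x + y)
    & forall (d : D) x, A x -> A (d%:F * x)].

Definition scale_set a A : set F := [set a * x | x in A].

(* finite sums of products; s lists the pairs of factors *)
Definition mul_set A B : set F :=
  [set z | exists2 s : seq (F * F),
     forall p, p \in s -> A p.1 /\ B p.2
   & z = \sum_(p <- s) p.1 * p.2].

Definition base_set : set F := range (fun d : D => d%:F).

Definition is_fractional A : Prop :=
  exists2 a, a != 0 & scale_set a A `<=` base_set.

Record nzsubmod : Type := NzSubmod {
  nzsubmod_set :> set F;
  _ : `[< is_submod nzsubmod_set /\ exists2 x, nzsubmod_set x & x != 0 >]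
}.

HB.instance Definition _ := [isSub for nzsubmod_set].
HB.instance Definition _ := [Choice of nzsubmod by <:].
HB.instance Definition _ :=
  [SubChoice_isSubPOrder of nzsubmod by <: with set_display].

Record fracideal : Type := FracIdeal {
  fracideal_submod :> nzsubmod;
  _ : `[< is_fractional fracideal_submod >]
}.

HB.instance Definition _ := [isSub for fracideal_submod].
HB.instance Definition _ := [Choice of fracideal by <:].
HB.instance Definition _ :=
  [SubChoice_isSubPOrder of fracideal by <: with set_display].

Lemma le_nzsubmod (I J : nzsubmod) :
  ((I <= J)%O : Prop) = ((I : set F) `<=` J).
Proof. by rewrite -subsetEset. Qed.

Lemma le_fracideal (I J : fracideal) :
  ((I <= J)%O : Prop) = ((I : set F) `<=` J).
Proof. by rewrite -subsetEset. Qed.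

Lemma nzsubmodP (I : nzsubmod) : is_submod I.
Proof. by case: I => A /= /asboolP[]. Qed.

Lemma nzsubmod_neq0 (I : nzsubmod) : exists2 x, (I : set F) x & x != 0.
Proof. by case: I => A /= /asboolP[]. Qed.

Lemma fracidealP (I : fracideal) : is_fractional I.
Proof. by case: I => A /= /asboolP. Qed.

Lemma mk_nzsubmod A :
  is_submod A -> (exists2 x, A x & x != 0) ->
  `[< is_submod A /\ exists2 x, A x & x != 0 >].
Proof. by move=> ? ?; apply/asboolP; split. Qed.

Lemma scale_submod a A : is_submod A -> is_submod (scale_set a A).
Proof.
case=> A0 AD AZ; split; first by exists 0; rewrite ?mulr0.
  by move=> _ _ [x Ax <-] [y Ay <-]; exists (x + y); rewrite ?mulrDr//; apply: AD.
by move=> d _ [x Ax <-]; exists (d%:F * x); [apply: AZ | rewrite mulrCA].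
Qed.

Lemma base_submod : is_submod base_set.
Proof.
split; first by exists 0; rewrite ?tofrac0.
  by move=> _ _ [x _ <-] [y _ <-]; exists (x + y); rewrite ?tofracD.
by move=> d _ [x _ <-]; exists (d * x); rewrite ?tofracM.
Qed.

Lemma mul_submod A B : is_submod A -> is_submod (mul_set A B).
Proof.
case=> A0 AD AZ; split; first by exists [::]; rewrite ?big_nil.
  move=> _ _ [s sAB ->] [t tAB ->]; exists (s ++ t); last by rewrite big_cat.
  by move=> p; rewrite mem_cat => /orP[/sAB|/tAB].
move=> d _ [s sAB ->]; exists [seq (d%:F * p.1, p.2) | p <- s].
  by move=> _ /mapP[p /sAB[Ap Bp] ->] /=; split => //; apply: AZ.
by rewrite big_map mulr_sumr; apply: eq_bigr => p _ /=; rewrite mulrA.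
Qed.

Lemma mem_mul_set A B x y : A x -> B y -> mul_set A B (x * y).
Proof.
move=> Ax By; exists [:: (x, y)]; last by rewrite big_seq1.
by move=> p; rewrite inE => /eqP->.
Qed.

Lemma mul_set_sub A B C : is_submod C ->
  (forall x y, A x -> B y -> C (x * y)) -> mul_set A B `<=` C.
Proof.
case=> C0 CD _ ABC _ [s sAB ->]; rewrite big_seq.
by elim/big_ind: _ => // p /sAB[Ap Bp]; apply: ABC.
Qed.

Lemma scale_neq0 a A : a != 0 -> (exists2 x, A x & x != 0) ->
  exists2 x, scale_set a A x & x != 0.
Proof. by move=> a0 [x Ax x0]; exists (a * x); [exists x | rewrite mulf_neq0]. Qed.

Lemma mul_neq0 A B : (exists2 x, A x & x != 0) -> (exists2 x, B x & x != 0) ->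
  exists2 x, mul_set A B x & x != 0.
Proof.
move=> [x Ax x0] [y By y0]; exists (x * y); last by rewrite mulf_neq0.
exact: mem_mul_set.
Qed.

Lemma base_neq0 : exists2 x, base_set x & x != 0.
Proof. by exists 1; rewrite ?oner_neq0//; exists 1; rewrite ?tofrac1. Qed.

Definition nzsubmod_base : nzsubmod :=
  NzSubmod (mk_nzsubmod base_submod base_neq0).

Definition nzsubmod_scale a (a0 : a != 0) (I : nzsubmod) : nzsubmod :=
  NzSubmod (mk_nzsubmod (scale_submod a (nzsubmodP I))
                        (scale_neq0 a0 (nzsubmod_neq0 I))).

Definition nzsubmod_mul (I J : nzsubmod) : nzsubmod :=
  NzSubmod (mk_nzsubmod (@mul_submod I J (nzsubmodP I))
                        (mul_neq0 (nzsubmod_neq0 I) (nzsubmod_neq0 J))).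

Lemma base_fractional : `[< is_fractional nzsubmod_base >].
Proof.
apply/asboolP; exists 1; first exact: oner_neq0.
by move=> _ [x Dx <-]; rewrite mul1r.
Qed.

Lemma scale_fractional a (a0 : a != 0) (I : fracideal) :
  `[< is_fractional (nzsubmod_scale a0 I) >].
Proof.
apply/asboolP; have [b b0 bI] := fracidealP I.
exists (b / a); first by rewrite mulf_neq0 ?invr_neq0.
by move=> _ [_ [x Ix <-] <-]; rewrite mulrA divfK//; apply: bI; exists x.
Qed.

Lemma mul_fractional (I J : fracideal) :
  `[< is_fractional (nzsubmod_mul I J) >].
Proof.
apply/asboolP; have [a a0 aI] := fracidealP I; have [b b0 bJ] := fracidealP J.
exists (a * b); first by rewrite mulf_neq0.
move=> _ [_ [s sIJ ->] <-]; rewrite mulr_sumr big_seq.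
have [D0 DD _] := base_submod.
elim/big_ind: _ => // p /sIJ[Ip Jp]; rewrite mulrACA.
have [c _ <-] : base_set (a * p.1) by apply: aI; exists p.1.
have [d _ <-] : base_set (b * p.2) by apply: bJ; exists p.2.
by exists (c * d); rewrite ?tofracM.
Qed.

Definition fracideal_base : fracideal := FracIdeal base_fractional.

Definition fracideal_scale a (a0 : a != 0) (I : fracideal) : fracideal :=
  FracIdeal (scale_fractional a0 I).

Definition fracideal_mul (I J : fracideal) : fracideal :=
  FracIdeal (mul_fractional I J).

HB.instance Definition _ := hasMul.Build fracideal fracideal_mul.

Lemma fracideal_le_mul (I J I' J' : fracideal) :
  (I <= I')%O -> (J <= J')%O -> (I * J <= I' * J')%O%g.
Proof.
rewrite !le_fracideal => II' JJ' _ [s sIJ ->]; exists s => // p /sIJ[? ?].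
by split; [apply: II' | apply: JJ'].
Qed.

HB.instance Definition _ :=
  Magma_isOrdered.Build set_display fracideal fracideal_le_mul.

Lemma fraction_numden a : exists n d : D, d != 0 /\ a * d%:F = n%:F.
Proof.
elim/quotW: a => x; exists \n_x, \d_x; split; first exact: denom_ratioP.
change (FracField.mul (\pi_(FracField.type D) x) (tofrac \d_x) = tofrac \n_x).
rewrite !piE /FracField.mulf !numden_Ratio ?oner_neq0 ?mulr1 ?denom_ratioP//.
apply/eqmodP; rewrite /= FracField.equivfE !numden_Ratio ?oner_neq0//.
by rewrite mulr1 mulrC.
all: exact: denom_ratioP.
Qed.

Lemma denominatorP A : is_fractional A ->
  exists2 d : D, d != 0 & scale_set d%:F A `<=` base_set.
Proof.
move=> [a a0 aA]; have [n [d [d0 Ea]]] := fraction_numden a.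
exists n; first by rewrite -tofrac_eq0 -Ea mulf_neq0 ?tofrac_eq0.
have [_ _ DZ] := base_submod.
move=> _ [x Ax <-]; rewrite -Ea mulrAC mulrC.
by apply: DZ; apply: aA; exists x.
Qed.

Lemma common_denominator (X : set fracideal) :
  finite_set X \/ has_ubound X ->
  exists2 a, a != 0 & forall I : fracideal, X I -> scale_set a I `<=` base_set.
Proof.
case=> [|[B BX]]; last first.
  have [a a0 aB] := fracidealP B; exists a => // I XI _ [x Ix <-].
  by apply: aB; exists x => //; have := BX _ XI; rewrite le_fracideal; apply.
case/finite_seqP => s ->; suff [d d0 ds] : exists2 d : D, d != 0 &
    forall I : fracideal, I \in s -> scale_set d%:F I `<=` base_set.
  by exists d%:F => //; rewrite tofrac_eq0.
elim: s => [|J s [d d0 ds]]; first by exists 1; rewrite ?oner_neq0.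
have [e e0 eJ] := denominatorP (fracidealP J).
have [_ _ DZ] := base_submod.
exists (d * e); first by rewrite mulf_neq0.
move=> I; rewrite inE => /orP[/eqP->|Is] _ [x Ix <-]; rewrite tofracM.
  by rewrite -mulrA; apply: DZ; apply: eJ; exists x.
by rewrite mulrAC mulrC; apply: DZ; apply: ds Is _ _; exists x.
Qed.

Definition sup_set (X : set fracideal) : set F :=
  smallest is_submod (\bigcup_(I in X) (I : set F)).

Lemma sup_set_ub (X : set fracideal) I : X I -> (I : set F) `<=` sup_set X.
Proof. by move=> XI x Ix M [_ XM]; apply: XM; exists I. Qed.

Lemma sup_set_min (X : set fracideal) A : is_submod A ->
  (forall I, X I -> (I : set F) `<=` A) -> sup_set X `<=` A.
Proof. by move=> sA XA x; apply; split=> // y [I /XA]; apply. Qed.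

Lemma sup_submod (X : set fracideal) : is_submod (sup_set X).
Proof.
split; first by move=> M [[]].
  by move=> x y sx sy M MX; have [[_ MD _] _] := MX; apply: MD; [apply: sx|apply: sy].
by move=> d x sx M MX; have [[_ _ MZ] _] := MX; apply: MZ; apply: sx.
Qed.

Lemma colon_submod a A : is_submod A -> is_submod [set x | A (a * x)].
Proof.
move=> [A0 AD AZ]; split => /=; first by rewrite mulr0.
  by move=> x y Ax Ay; rewrite mulrDr; apply: AD.
by move=> d x Ax; rewrite mulrCA; apply: AZ.
Qed.

Lemma sup_nzsubmod (X : set fracideal) : X !=set0 ->
  `[< is_submod (sup_set X) /\ exists2 x, sup_set X x & x != 0 >].
Proof.
move=> [I XI]; apply: mk_nzsubmod; first exact: sup_submod.
by have [x Ix x0] := nzsubmod_neq0 I; exists x => //; apply: sup_set_ub XI _ Ix.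
Qed.

Lemma sup_fractional (X : set fracideal) (X0 : X !=set0) :
  finite_set X \/ has_ubound X ->
  `[< is_fractional (NzSubmod (sup_nzsubmod X0)) >].
Proof.
move=> /common_denominator[a a0 aX]; apply/asboolP; exists a => //.
move=> _ [x sx <-]; apply: (sup_set_min (colon_submod a base_submod)) sx.
by move=> I XI y Iy; apply: aX XI _ _; exists y.
Qed.

Lemma sup_supremums (X : set fracideal) (X0 : X !=set0)
    (fX : finite_set X \/ has_ubound X) :
  supremums X (FracIdeal (sup_fractional X0 fX)).
Proof.
split=> [I XI|J JX]; rewrite le_fracideal; first exact: sup_set_ub.
by apply: sup_set_min; [apply: nzsubmodP | move=> I /JX; rewrite le_fracideal].
Qed.

Lemma fracideal_supremums_neq0 (X : set fracideal) : X !=set0 ->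
  finite_set X \/ has_ubound X -> supremums X !=set0.
Proof. by move=> X0 fX; exists (FracIdeal (sup_fractional X0 fX)); apply: sup_supremums. Qed.

Lemma fracideal_mulC : commutative fracideal_mul.
Proof.
move=> I J; apply/le_anti/andP.
by split; rewrite le_fracideal; apply: mul_set_sub; rewrite /=;
  do ?[exact: (mul_submod _ (nzsubmodP _))];
  move=> x y Ix Jy; rewrite mulrC; apply: mem_mul_set.
Qed.

Lemma fracideal_supremums_mull (a : fracideal) (X : set fracideal)
    (s : fracideal) : X !=set0 -> finite_set X \/ has_ubound X ->
  supremums X s -> supremums [set (a * x)%g | x in X] (a * s)%g.
Proof.
move=> X0 fX [Xs sX]; split=> [_ [x Xx <-]|B BX].
  by apply: fracideal_le_mul => //; apply: Xs.
have [ubX _] := sup_supremums X0 fX; have := sX _ ubX.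
rewrite !le_fracideal => s_sub; apply: mul_set_sub; first exact: nzsubmodP.
move=> y z ay /s_sub /= sz.
apply: (sup_set_min (colon_submod y (nzsubmodP B))) sz => x Xx w xw /=.
have : (a * x <= B)%O%g by apply: BX; exists x.
by rewrite le_fracideal; apply; apply: mem_mul_set.
Qed.

Lemma fracideal_supremums_mulr (a : fracideal) (X : set fracideal)
    (s : fracideal) : X !=set0 -> finite_set X \/ has_ubound X ->
  supremums X s -> supremums [set (x * a)%g | x in X] (s * a)%g.
Proof.
move=> X0 fX /(fracideal_supremums_mull a X0 fX).
rewrite [(s * a)%g]fracideal_mulC; congr (supremums _ _).
by apply: eq_imagel => x _; apply: fracideal_mulC.
Qed.

HB.instance Definition _ :=
  OrderedMagma_isSemiprequantale.Build set_display fracideal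
    fracideal_supremums_neq0 fracideal_supremums_mull fracideal_supremums_mulr.

Definition star_operation (star : fracideal -> fracideal) : Prop :=
  [/\ closure_operation star,
      star fracideal_base = fracideal_base
    & forall a (a0 : a != 0) I,
        star (fracideal_scale a0 I) = fracideal_scale a0 (star I)].

Definition semistar_operation (star : nzsubmod -> nzsubmod) : Prop :=
  closure_operation star /\
  forall a (a0 : a != 0) I,
    star (nzsubmod_scale a0 I) = nzsubmod_scale a0 (star I).

End Submodules.

(* Main.v *)
Require Import Defs.
From mathcomp Require Import all_boot all_order all_algebra.
From mathcomp Require Import all_classical.

(** Multiplication by [a] is multiplication by the principal ideal [aD], and
  [IJ] is the sum of the [aJ] for [a] in [I]; so compatibility with scaling,
  [aJ^* <= (aJ)^*], passes to products, [IJ^* <= (IJ)^*], and conversely.  A star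
  operation extends to a semistar operation by sending each nonfractional
  submodule to the quotient field. *)

Set Implicit Arguments.
Unset Strict Implicit.
Unset Printing Implicit Defensive.

Import Order.TTheory GRing.Theory.
Local Open Scope classical_set_scope.
Local Open Scope ring_scope.

(** * Multiplication and scaling of fractional ideals *)

Section FracidealMul.
Variable D : idomainType.
Local Notation F := {fraction D}.
Implicit Types (I J K : fracideal D) (a : F).

Lemma fracideal_mul_le I J K :
  (I * J <= K)%O%g <->
  (forall x y, (I : set F) x -> (J : set F) y -> (K : set F) (x * y)).
Proof.
rewrite le_fracideal; split=> [IJK x y Ix Jy|IJK].
  by apply: IJK; apply: mem_mul_set.
by apply: mul_set_sub => //; apply: nzsubmodP.
Qed.

Lemma fracideal_mulA (I J K : fracideal D) : (I * (J * K) = I * J * K)%g.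
Proof.
apply/le_anti/andP; split; apply/fracideal_mul_le => x y.
  (* The [u] with [x * u] in [IJK] form a submodule, so it is enough to test products that generate
     [JK]. *)
  move=> Ix; have KS := colon_submod x (nzsubmodP (I * J * K)%g).
  apply: (mul_set_sub KS) => u v Ju Kv /=; rewrite mulrA.
  by do 2!apply: mem_mul_set => //.
move=> IJx Ky; rewrite mulrC; move: x IJx.
apply: (mul_set_sub (colon_submod y (nzsubmodP (I * (J * K))%g))) => u v Iu Jv /=.
rewrite mulrC -mulrA.
by do 2!apply: mem_mul_set => //.
Qed.

(** Through [aD], conditions that mention only products of ideals yield statements about scalars. *)
Lemma fracideal_scaleE a (a0 : a != 0) I :
  fracideal_scale a0 I = (fracideal_scale a0 (fracideal_base D) * I)%g.
Proof.
apply/le_anti/andP; split; last first.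
  apply/fracideal_mul_le => _ y [_ [d _ <-] <-] Iy; rewrite -mulrA.
  by exists (tofrac d * y) => //; have [_ _] := nzsubmodP I; apply.
rewrite le_fracideal => _ [x Ix <-]; apply: mem_mul_set => //.
by exists 1; [exists 1; rewrite ?tofrac1 | rewrite mulr1].
Qed.

Lemma fracideal_mul1 I : (fracideal_base D * I = I)%g.
Proof.
apply/le_anti/andP; split.
  apply/fracideal_mul_le => _ y [d _ <-] Iy.
  by have [_ _] := nzsubmodP I; apply.
rewrite le_fracideal => x Ix; rewrite -[x]mul1r; apply: mem_mul_set => //.
by exists 1; rewrite ?tofrac1.
Qed.

Lemma fracideal_scaleK a (a0 : a != 0) (b0 : a^-1 != 0) I :
  fracideal_scale a0 (fracideal_scale b0 I) = I.
Proof.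
apply/le_anti/andP; split; rewrite le_fracideal => x.
  by move=> [_ [y Iy <-] <-]; rewrite mulVKf.
by move=> Ix; exists (a^-1 * x); [exists x | rewrite mulVKf].
Qed.

Lemma fracideal_scaleVK a (a0 : a != 0) (b0 : a^-1 != 0) I :
  fracideal_scale b0 (fracideal_scale a0 I) = I.
Proof.
apply/le_anti/andP; split; rewrite le_fracideal => x.
  by move=> [_ [y Iy <-] <-]; rewrite mulKf.
by move=> Ix; exists (a * x); [exists x | rewrite mulKf].
Qed.

Lemma le_fracideal_scale a (a0 : a != 0) I J :
  (I <= J)%O -> (fracideal_scale a0 I <= fracideal_scale a0 J)%O.
Proof. by rewrite !le_fracideal => IJ _ [x /IJ Jx <-]; exists x. Qed.

End FracidealMul.

(** * Star operations and nuclei *)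

Section StarOperations.
Variables (D : idomainType) (star : fracideal D -> fracideal D).
Local Notation F := {fraction D}.
Local Notation base := (fracideal_base D).
Implicit Types (I J K : fracideal D) (a : F).

(** Scalars are invertible: the assumed inclusion for [a^-1] and [aI] gives [a^-1 (aI)^* <= I^*],
    which is the reverse inclusion after scaling by [a]. *)
Lemma star_operation_le_scale :
  closure_operation star -> star base = base ->
  (forall a (a0 : a != 0) I,
     (fracideal_scale a0 (star I) <= star (fracideal_scale a0 I))%O) ->
  star_operation star.
Proof.
move=> starC starD sZ; split=> // a a0 I; apply/le_anti; rewrite sZ andbT.
have b0 : a^-1 != 0 by rewrite invr_eq0.
rewrite -[leLHS](fracideal_scaleK a0 b0); apply: le_fracideal_scale.
by apply: le_trans (sZ _ _ _) _; rewrite fracideal_scaleVK.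
Qed.

Lemma star_operation_nucleus : star_operation star -> nucleus star.
Proof.
move=> [[ext mono idem] _ sZ]; split=> //.
have sM I J : (I * star J <= star (I * J))%O%g.
  apply/fracideal_mul_le => x y Ix Jy.
  (* Only nonzero scalars act on ideals. For [x != 0], [xJ <= IJ] gives
     [xJ^* = (xJ)^* <= (IJ)^*]. *)
  have [->|x0] := eqVneq x 0.
    by rewrite mul0r; have [] := nzsubmodP (star (I * J)%g).
  have : (star (fracideal_scale x0 J) <= star (I * J)%g)%O.
    apply: mono; rewrite le_fracideal => _ [z Jz <-].
    exact: mem_mul_set.
  by rewrite sZ le_fracideal; apply; exists y.
(* The one-sided inclusion is used once per factor: [I^*J^* <= (I^*J)^* <= (IJ)^{**}]. *)
move=> I J; apply: le_trans (sM _ _) _; rewrite -[leRHS]idem; apply: mono.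
rewrite [(star I * J)%g]fracideal_mulC [(I * J)%g]fracideal_mulC.
exact: sM.
Qed.

(** Here [aI^* = (aD)I^* <= (aD)^*I^* <= (aI)^*]. *)
Lemma nucleus_star_operation :
  nucleus star -> star base = base -> star_operation star.
Proof.
move=> [starC sM] starD; apply: star_operation_le_scale => // a a0 I.
rewrite (fracideal_scaleE a0 (star I)) (fracideal_scaleE a0 I).
apply: le_trans (sM _ _); apply: le_mulg => //.
by have [ext _ _] := starC.
Qed.

(** * Associativity, absorption of inner stars, and the residual condition *)

Lemma nucleus_mul :
  nucleus star -> forall I J, star (I * star J)%g = star (I * J)%g.
Proof.
move=> [[ext mono idem] sM] I J; apply/le_anti/andP; split.
  rewrite -[leRHS]idem; apply: mono; apply: le_trans (sM _ _).
  exact: le_mulg.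
by apply: mono; apply: le_mulg.
Qed.

(** Both bracketings reduce to [(IJK)^*] once the inner star is absorbed. *)
Lemma nucleus_associative :
  nucleus star -> associative (fun I J => star (I * J)%g).
Proof.
move=> sN I J K; rewrite nucleus_mul// [(star _ * K)%g]fracideal_mulC.
by rewrite nucleus_mul// [(K * _)%g]fracideal_mulC fracideal_mulA.
Qed.

Lemma associative_star_mul :
  closure_operation star -> associative (fun I J => star (I * J)%g) ->
  forall I J, star (star I * star J)%g = star (I * J)%g.
Proof.
move=> [_ _ idem] sA.
have sM I J : star (star I * J)%g = star (I * J)%g.
  (* Associativity at the triple [D, I, J] reads [(IJ)^{**} = (I^*J)^*]. *)
  by have := sA base I J; rewrite !fracideal_mul1 idem.
move=> I J; rewrite sM [(I * star J)%g]fracideal_mulC sM.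
by rewrite [(J * I)%g]fracideal_mulC.
Qed.

Lemma star_mul_residual :
  closure_operation star ->
  (forall I J, star (star I * star J)%g = star (I * J)%g) ->
  forall I J K, (I * J <= star K)%O%g <-> (I * star J <= star K)%O%g.
Proof.
move=> [ext mono idem] sM I J K; split; last by apply: le_trans; apply: le_mulg.
move=> /mono; rewrite idem -sM; apply: le_trans.
by apply: le_trans (ext _); apply: le_mulg.
Qed.

(** Taking [I = D] makes [J <= K^*] equivalent to [J^* <= K^*], which encodes all three closure
    axioms; taking [I = aD] gives [aJ^* <= (aJ)^*]. *)
Lemma residual_star_operation :
  star base = base ->
  (forall I J K, (I * J <= star K)%O%g <-> (I * star J <= star K)%O%g) ->
  star_operation star.
Proof.
move=> starD sR.
have sP J K : (J <= star K)%O <-> (star J <= star K)%O.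
  by have := sR base J K; rewrite !fracideal_mul1.
have ext I : (I <= star I)%O by apply/sP.
apply: star_operation_le_scale => //.
  split=> // [I J IJ|I]; first by apply: (sP _ _).1; apply: le_trans (ext J).
  by apply/le_anti; rewrite ext andbT; apply: (sP _ _).1.
by move=> a a0 I; rewrite fracideal_scaleE; apply: (sR _ _ _).1; rewrite -fracideal_scaleE.
Qed.

(** * Extension to, and restriction from, semistar operations *)

Lemma full_nzsubmod_subproof :
  `[< is_submod [set: F] /\ exists2 x, [set: F] x & x != 0 >].
Proof. by apply: mk_nzsubmod => //; exists 1; rewrite ?oner_neq0. Qed.

Definition full_nzsubmod : nzsubmod D := NzSubmod full_nzsubmod_subproof.

Definition semistar_ext (I : nzsubmod D) : nzsubmod D :=
  if pselect (is_fractional I) is left fI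
  then star (FracIdeal (introT (asboolP _) fI)) else full_nzsubmod.

Lemma semistar_ext_frac I : semistar_ext I = star I.
Proof.
rewrite /semistar_ext; case: pselect => [fI|[]]; last exact: fracidealP.
(* The ideal rebuilt by [semistar_ext] may carry another proof of fractionality, but has the same
   underlying submodule. *)
by congr (fracideal_submod (star _)); apply: val_inj.
Qed.

Lemma semistar_ext_nfrac (I : nzsubmod D) :
  ~ is_fractional I -> semistar_ext I = full_nzsubmod.
Proof. by rewrite /semistar_ext; case: pselect. Qed.

Lemma le_full_nzsubmod (I : nzsubmod D) : (I <= full_nzsubmod)%O.
Proof. by rewrite le_nzsubmod. Qed.

Lemma is_fractional_fracideal (I : nzsubmod D) :
  is_fractional I -> exists J : fracideal D, I = J.
Proof. by move=> fI; exists (FracIdeal (introT (asboolP _) fI)). Qed.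

Lemma full_nzsubmodP (I : nzsubmod D) : (full_nzsubmod <= I)%O -> I = full_nzsubmod.
Proof. by move=> FI; apply/le_anti; rewrite le_full_nzsubmod. Qed.

(** Fractionality passes to smaller submodules and is invariant under nonzero scaling, so the two
    cases of the extension fit together. *)
Lemma semistar_ext_semistar :
  star_operation star -> semistar_operation semistar_ext.
Proof.
move=> [[ext mono idem] _ sZ].
have extE (I : nzsubmod D) : (I <= semistar_ext I)%O.
  have [/is_fractional_fracideal[J ->]|nI] := pselect (is_fractional I).
    by rewrite semistar_ext_frac; apply: ext.
  by rewrite semistar_ext_nfrac// le_full_nzsubmod.
split; first split=> //.
- move=> I J IJ.
  have [fJ|nJ] := pselect (is_fractional J); last first.
    by rewrite (semistar_ext_nfrac nJ) le_full_nzsubmod.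
  have fI : is_fractional I.
    have [a a0 aJ] := fJ; exists a => // _ [x Ix <-]; apply: aJ; exists x => //.
    by move: IJ; rewrite le_nzsubmod; apply.
  have [J' EJ] := is_fractional_fracideal fJ.
  have [I' EI] := is_fractional_fracideal fI.
  by move: IJ; rewrite EI EJ !semistar_ext_frac => IJ; apply: mono.
- move=> I; have [/is_fractional_fracideal[J ->]|nI] := pselect (is_fractional I).
    by rewrite !semistar_ext_frac idem.
  (* Expansiveness alone forces [F] to be fixed. *)
  by rewrite (semistar_ext_nfrac nI); apply: full_nzsubmodP; apply: extE.
- move=> a a0 I.
  have [/is_fractional_fracideal[J ->]|nI] := pselect (is_fractional I).
    rewrite semistar_ext_frac -[nzsubmod_scale _ _]/(fracideal_submod (fracideal_scale a0 J)).
    by rewrite semistar_ext_frac sZ.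
  rewrite !semistar_ext_nfrac//.
    (* [aF = F], since [a] is invertible. *)
    apply/esym; apply: full_nzsubmodP; rewrite le_nzsubmod => x _.
    by exists (a^-1 * x) => //; rewrite mulVKf.
  (* If [b] clears the denominators of [aI], then [ba] clears those of [I]. *)
  move=> [b b0 bI]; apply: nI; exists (b * a); first by rewrite mulf_neq0.
  by move=> _ [x Ix <-]; rewrite -mulrA; apply: bI; exists (a * x) => //; exists x.
Qed.

Lemma semistar_restrict_star (sstar : nzsubmod D -> nzsubmod D) :
  semistar_operation sstar -> star base = base ->
  (forall I, fracideal_submod (star I) = sstar I) -> star_operation star.
Proof.
move=> [[ext mono idem] sZ] starD starE.
have subI I J : fracideal_submod I = fracideal_submod J -> I = J.
  exact: val_inj.
have suble I J : (fracideal_submod I <= fracideal_submod J)%O -> (I <= J)%O.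
  by [].
split=> //; first split.
- by move=> I; apply: suble; rewrite starE.
- by move=> I J IJ; apply: suble; rewrite !starE; apply: mono.
- by move=> I; apply: subI; rewrite !starE idem.
- by move=> a a0 I; apply: subI; rewrite starE /= starE -sZ.
Qed.

End StarOperations.

Theorem theorem13p3 (D : idomainType) :
  (forall star : fracideal D -> fracideal D,
     star_operation star <->
     nucleus star /\ star (fracideal_base D) = fracideal_base D) /\
  (forall star : fracideal D -> fracideal D,
     star (fracideal_base D) = fracideal_base D ->
     [<-> star_operation star;
          closure_operation star /\
            associative (fun I J : fracideal D => star (I * J)%g);
          closure_operation star /\
            (forall I J : fracideal D, star (star I * star J)%g = star (I * J)%g);
          forall I J K : fracideal D,
            (I * J <= star K)%O%g <-> (I * star J <= star K)%O%g;
          exists sstar : nzsubmod D -> nzsubmod D,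
            [/\ semistar_operation sstar,
                sstar (nzsubmod_base D) = nzsubmod_base D
              & forall I : fracideal D,
                  fracideal_submod (star I) = sstar (fracideal_submod I)]]).
Proof.
split=> star.
  split=> [sS|[sN]]; last exact: nucleus_star_operation.
  by split; [apply: star_operation_nucleus | have [] := sS].
move=> starD; tfae.
- move=> sS; split; first by have [] := sS.
  exact/nucleus_associative/star_operation_nucleus.
- by move=> [sC sA]; split=> //; apply: associative_star_mul.
- by move=> [sC sM]; apply: star_mul_residual.
(* The residual condition is first turned back into a star operation, which is then extended. *)
- move=> sR; exists (semistar_ext star); split.
  + exact/semistar_ext_semistar/residual_star_operation.
  + by rewrite -[nzsubmod_base D]/(fracideal_submod (fracideal_base D)) semistar_ext_frac starD.
  + by move=> I; rewrite semistar_ext_frac.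
- by move=> [sstar [sS _ starE]]; apply: semistar_restrict_star sS _ _.
Qed.
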